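(* Let $\Lambda$ be a finite dimensional algebra over a field, let $k\ge1$ be an integer and let $0\to A\to B\to C\to0$ be a short exact sequence of finitely generated right $\Lambda$-modules with $k\text{-}\operatorname{ddell}A=m_1$ and $k\text{-}\operatorname{ddell}C=m_2$, where $m_1,m_2$ are nonnegative integers. Then $k\text{-}\operatorname{ddell}B\le m_1+m_2+1$.
   Context: $\mathrm{mod}\,\Lambda$ is the category of finitely generated right $\Lambda$-modules. $\mathbb N$ is the set of nonnegative integers; the infimum of the empty set is $+\infty$. $\Omega M$ is the kernel of a projective cover of $M$, $\Omega^0M=M$, $\Omega^{n+1}M=\Omega(\Omega^nM)$. ''$U$ is a direct summand of $V$ up to projective summands'' means that $U$ is isomorphic to a direct summand of $V\oplus P$ for some projective $P$. For an integer $j\ge1$, $j\text{-}\operatorname{dell}M$ is the infimum of all $n\in\mathbb N$ such that $\Omega^nM$ is a direct summand of $\Omega^{n+j}N$ up to projective summands for some $N\in\mathrm{mod}\,\Lambda$. $k\text{-}\operatorname{ddell}M$ is the infimum of all $m\in\mathbb N$ for which there exist $0\le n\le m$ and an exact sequence $0\to C_n\to\cdots\to C_1\to C_0\to M\to0$ in $\mathrm{mod}\,\Lambda$ with $(i+k)\text{-}\operatorname{dell}C_i\le m-i$ for $i=0,\dots,n$. *)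

(* Defs.v *)
From HB Require Import structures.
From mathcomp Require Import all_boot all_algebra all_field.
From mathcomp Require Import boolp.

Set Implicit Arguments.
Unset Strict Implicit.
Unset Printing Implicit Defensive.

Import GRing.Theory.
Local Open Scope ring_scope.

(* A right module over Lambda is a left module over the converse ring:
   for a : Lambda^c, [a *: x] stands for x.a. *)
Notation rmodType Lambda := (lmodType (Lambda : nzRingType)^c).

(* N with +oo adjoined, [None] being +oo. *)
Definition natoo := option nat.

Definition le_natoo (x y : natoo) : bool :=
  match x, y with
  | _, None => true
  | None, Some _ => false
  | Some m, Some n => (m <= n)%N
  end.

Definition inf_natoo (P : nat -> Prop) : natoo :=
  match pselect (exists n, `[< P n >]) with
  | left exP => Some (ex_minn exP)
  | right _ => None
  end.

Section Modules.
Variable R : nzRingType.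
Implicit Types M N K P U V W X Y : lmodType R.

Definition fin_gen M : Prop :=
  exists (n : nat) (e : 'I_n -> M),
    forall x : M, exists c : 'I_n -> R, x = \sum_i c i *: e i.

Definition onto M N (f : M -> N) : Prop := forall y, exists x, f x = y.

Definition exact_at M N K (f : {linear M -> N}) (g : {linear N -> K}) : Prop :=
  forall y, g y = 0 <-> exists x, f x = y.

Definition short_exact M N K (f : {linear M -> N}) (g : {linear N -> K}) :
    Prop :=
  [/\ injective f, exact_at f g & onto g].

Definition mod_iso M N : Prop := exists f : {linear M -> N}, bijective f.

Definition projective P : Prop :=
  forall X Y (g : {linear X -> Y}) (f : {linear P -> Y}), onto g ->
    exists h : {linear P -> X}, forall x, g (h x) = f x.

Definition essential_epi P M (p : {linear P -> M}) : Prop :=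
  onto p /\
  forall X (h : {linear X -> P}), onto (fun x => p (h x)) -> onto h.

Definition projective_cover P M (p : {linear P -> M}) : Prop :=
  [/\ fin_gen P, projective P & essential_epi p].

(* Omega M is only defined up to isomorphism, whence the relations
   "K is an Omega M" and "K is an Omega^n M". *)
Definition is_syzygy M K : Prop :=
  exists P (p : {linear P -> M}) (i : {linear K -> P}),
    [/\ projective_cover p, injective i & exact_at i p].

Fixpoint is_iter_syzygy (n : nat) M K : Prop :=
  if n is n'.+1 then exists L, is_iter_syzygy n' M L /\ is_syzygy L K
  else mod_iso M K.

Definition is_summand U V : Prop :=
  exists W, mod_iso (U * W)%type V.

Definition is_summand_upto_proj U V : Prop :=
  exists P, [/\ fin_gen P, projective P & is_summand U (V * P)%type].

Definition dell (j : nat) M : natoo :=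
  inf_natoo (fun n => exists N U V,
    [/\ fin_gen N, is_iter_syzygy n M U, is_iter_syzygy (n + j) N V
      & is_summand_upto_proj U V]).

(* An exact sequence 0 -> C n -> ... -> C 0 -> M -> 0 of finitely generated
   modules, prolonged by C i = 0 for i > n. *)
Definition finite_resolution (n : nat) M (C : nat -> lmodType R)
    (d : forall i, {linear C i.+1 -> C i}) (e : {linear C 0%N -> M}) : Prop :=
  [/\ forall i, fin_gen (C i),
      forall i, (n < i)%N -> forall x : C i, x = 0,
      onto e,
      exact_at (d 0%N) e
    & forall i, exact_at (d i.+1) (d i)].

Definition ddell (k : nat) M : natoo :=
  inf_natoo (fun m => exists n : nat, (n <= m)%N /\
    exists (C : nat -> lmodType R) (d : forall i, {linear C i.+1 -> C i})
           (e : {linear C 0%N -> M}),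
      finite_resolution n d e /\
      forall i, (i <= n)%N -> le_natoo (dell (i + k) (C i)) (Some (m - i)%N)).

End Modules.

(* Main.v *)
(* Splice resolutions. If A_0, ..., A_n1 resolves A and P_0, P_1, ... is a
   projective resolution of C, the horseshoe lemma resolves B by A_i + P_i for
   i <= n1, with remaining kernel the syzygy of order n1 + 1 of C; this works
   although the A_i are not projective, since only the maps out of the P_i have
   to be lifted. A resolution C_0, ..., C_n2 of C yields one of that kernel by
   syzygies of order n1 + 1 of the C_j. Taking syzygies of order s turns
   j-dell <= n into (s + j)-dell <= n, which matches the shift of the indices.

   Being a stable retract is preserved by syzygies with respect to arbitrary
   projective presentations, so minimality only enters through the existence
   of projective covers. *)
Require Import Defs.
From HB Require Import structures.
From mathcomp Require Import all_boot all_algebra all_field.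
From mathcomp Require Import boolp zify.

Set Implicit Arguments.
Unset Strict Implicit.
Unset Printing Implicit Defensive.

Import GRing.Theory.
Local Open Scope ring_scope.

(** * Linear maps and submodules *)

Section LinOf.
Variables (R : nzRingType) (M N : lmodType R) (f : M -> N) (fL : linear f).
Definition lin_of : {linear M -> N} :=
  HB.pack f (GRing.isLinear.Build R M N *:%R f fL).
End LinOf.

Section SubModule.
Variables (R : nzRingType) (M : lmodType R).

Definition submodule (S : M -> Prop) : Prop :=
  S 0 /\ forall a x y, S x -> S y -> S (a *: x + y).

Variables (S : M -> Prop) (hS : submodule S).

(** The proof of [submodule S] is an argument so that the closure instance can be attached to the
    predicate itself. *)
Definition subm_pred of submodule S : {pred M} := [pred x | `[< S x >]].

Lemma subm_pred_closed : submod_closed (subm_pred hS).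
Proof.
case: (hS) => S0 SP; split; first by apply/asboolP.
by move=> a x y /asboolP Sx /asboolP Sy; apply/asboolP/SP.
Qed.

HB.instance Definition _ :=
  GRing.isSubmodClosed.Build R M (subm_pred hS) subm_pred_closed.

Record subm := Subm { subm_val : M; subm_valP : subm_val \in subm_pred hS }.

HB.instance Definition _ := [isSub for subm_val].
HB.instance Definition _ := [Choice of subm by <:].
HB.instance Definition _ := [SubChoice_isSubLmodule of subm by <:].

Lemma submodule_exists : exists (I : lmodType R) (j : {linear I -> M}),
  injective j /\ forall x, S x <-> exists y, j y = x.
Proof.
exists subm, val; split=> [|x]; first exact: val_inj.
split=> [Sx|[y <-]]; last by apply/asboolP/(subm_valP y).
by exists (Subm (introT (asboolP _) Sx)).
Qed.

End SubModule.

(** * Modules, syzygies and stable retracts *)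

Section Modules.
Variable R : nzRingType.
Implicit Types L M N K P Q U V W X Y : lmodType R.

Lemma submodule_ker M N (f : {linear M -> N}) : submodule (fun x => f x = 0).
Proof. by split=> [|a x y fx fy]; rewrite ?linear0 // linearP fx fy scaler0 addr0. Qed.

Lemma kernel_exists M N (f : {linear M -> N}) :
  exists K (i : {linear K -> M}), injective i /\ exact_at i f.
Proof. exact: submodule_exists (submodule_ker f). Qed.

Lemma exact_at0 K M N (i : {linear K -> M}) (f : {linear M -> N}) x :
  exact_at i f -> f (i x) = 0.
Proof. by move=> E; apply/E; exists x. Qed.

(** Preimages under [i] are chosen pointwise; injectivity of [i] forces the choice to be linear. *)
Lemma lift_kernel X L P V (i : {linear L -> P}) (p : {linear P -> V})
    (f : {linear X -> P}) :
  injective i -> exact_at i p -> (forall x, p (f x) = 0) ->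
  exists e : {linear X -> L}, forall x, i (e x) = f x.
Proof.
move=> i_inj ex pf.
have /choice [e eP] : forall x, exists y, i y = f x by move=> x; apply/ex.
have eL : linear e by move=> a x y; apply: i_inj; rewrite !(linearP, eP).
by exists (lin_of eL).
Qed.

(** * Maps into and out of direct sums *)

Lemma pairmap_linear X M N (f : {linear X -> M}) (g : {linear X -> N}) :
  linear (fun x => (f x, g x) : (M * N)%type).
Proof. by move=> a x y; rewrite !linearP. Qed.

Definition pairmap X M N (f : {linear X -> M}) (g : {linear X -> N}) :=
  lin_of (pairmap_linear f g).

Lemma sumap_linear X M N (f : {linear M -> X}) (g : {linear N -> X}) :
  linear (fun x : (M * N)%type => f x.1 + g x.2).
Proof. by move=> a [x1 x2] [y1 y2]; rewrite /= !linearP scalerDr addrACA. Qed.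

Definition sumap X M N (f : {linear M -> X}) (g : {linear N -> X}) :=
  lin_of (sumap_linear f g).

Lemma prodmap_linear M N X Y (f : {linear M -> X}) (g : {linear N -> Y}) :
  linear (fun x => (f x.1, g x.2) : (X * Y)%type).
Proof. by move=> a [x1 x2] [y1 y2]; rewrite /= !linearP. Qed.

Definition prodmap M N X Y (f : {linear M -> X}) (g : {linear N -> Y}) :=
  lin_of (prodmap_linear f g).

Lemma inl_linear M N : linear (fun x => (x, 0) : (M * N)%type).
Proof. by move=> a x y; congr (_, _); rewrite /= scaler0 addr0. Qed.

Definition inl_map M N := lin_of (@inl_linear M N).

Lemma inr_linear M N : linear (fun x => (0, x) : (M * N)%type).
Proof. by move=> a x y; congr (_, _); rewrite /= scaler0 addr0. Qed.

Definition inr_map M N := lin_of (@inr_linear M N).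

Lemma mod_isoP M N : mod_iso M N <->
  exists (f : {linear M -> N}) (g : {linear N -> M}), cancel f g /\ cancel g f.
Proof.
split=> [[f [g fK gK]]|[f [g [fK gK]]]]; last by exists f, g.
have gL : linear g by move=> a x y; apply: (can_inj fK); rewrite linearP !gK.
by exists f, (lin_of gL).
Qed.

Lemma mod_iso_sym M N : mod_iso M N -> mod_iso N M.
Proof. by move=> /mod_isoP [f [g [fK gK]]]; exists g, f. Qed.

(** * Finitely generated, projective and free modules *)

Lemma fin_gen_onto M N (f : {linear M -> N}) : fin_gen M -> onto f -> fin_gen N.
Proof.
move=> [n [e eP]] fonto; exists n, (f \o e) => y.
have [x <-] := fonto y; have [c ->] := eP x; exists c.
by rewrite linear_sum; apply: eq_bigr => i _; rewrite linearZ.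
Qed.

Lemma fin_gen_prod M N : fin_gen M -> fin_gen N -> fin_gen (M * N)%type.
Proof.
move=> [n [e eP]] [m [f fP]].
exists (n + m)%N, (fun i => match split i with
  | inl i => inl_map M N (e i) | inr i => inr_map M N (f i) end) => -[x y].
have [c ->] := eP x; have [d ->] := fP y.
exists (fun i => match split i with inl i => c i | inr i => d i end).
have sl i : split (lshift m i) = inl i := unsplitK (inl i).
have sr i : split (rshift n i) = inr i := unsplitK (inr i).
rewrite big_split_ord /=; under [X in _ = X + _]eq_bigr => i _ do rewrite sl.
under [X in _ = _ + X]eq_bigr => i _ do rewrite sr.
transitivity (inl_map M N (\sum_i c i *: e i) + inr_map M N (\sum_i d i *: f i)).
  by apply/eqP; rewrite xpair_eqE /= addr0 add0r !eqxx.
by rewrite !linear_sum; congr (_ + _); apply: eq_bigr => i _; rewrite linearZ.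
Qed.

Lemma projective_prod P Q : projective P -> projective Q -> projective (P * Q)%type.
Proof.
move=> prP prQ X Y g f gonto.
have [h1 h1P] := prP X Y g (f \o inl_map P Q) gonto.
have [h2 h2P] := prQ X Y g (f \o inr_map P Q) gonto.
exists (sumap h1 h2) => -[x y] /=; rewrite linearD h1P h2P /= -linearD.
by congr (f (_, _)); rewrite /= ?addr0 ?add0r.
Qed.

(** For [R] the converse of Lambda, [R^o] is the regular right Lambda-module. [freemod 0] serves as
    the zero module throughout. *)
Definition freemod n : lmodType R := {ffun 'I_n -> R^o}.

Lemma freemap_linear n M (e : 'I_n -> M) :
  linear (fun v : freemod n => \sum_i v i *: e i).
Proof.
move=> a x y; rewrite scaler_sumr -big_split; apply: eq_bigr => i _ /=.
by rewrite !ffunE scalerDl scalerA.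
Qed.

Definition freemap n M (e : 'I_n -> M) := lin_of (freemap_linear e).

Definition freebase n (i : 'I_n) : freemod n := [ffun j => (i == j)%:R].

Lemma freebaseE n (v : freemod n) : v = \sum_i v i *: freebase i.
Proof.
apply/ffunP => j; rewrite sum_ffunE (bigD1 j) //= big1 => [|i /negPf ij].
  by rewrite !ffunE eqxx addr0 /GRing.scale /= mulr1.
by rewrite !ffunE ij scaler0.
Qed.

Lemma fin_gen_free n : fin_gen (freemod n).
Proof. by exists n, (@freebase n) => v; exists v; apply: freebaseE. Qed.

Lemma projective_free n : projective (freemod n).
Proof.
move=> X Y g f gonto.
have /choice [x xP] : forall i, exists x, g x = f (freebase i) by move=> i.
exists (freemap x) => v; rewrite [in RHS](freebaseE v) !linear_sum.
by apply: eq_bigr => i _; rewrite !linearZ xP.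
Qed.

Lemma free_cover M : fin_gen M -> exists n (p : {linear freemod n -> M}), onto p.
Proof.
move=> [n [e eP]]; exists n, (freemap e) => y; have [c ->] := eP y.
by exists [ffun i => c i]; apply: eq_bigr => i _; rewrite ffunE.
Qed.

(** * Syzygies of arbitrary projective presentations *)

(* Like [is_syzygy], but for an arbitrary projective presentation. *)
Definition presyz M K : Prop :=
  exists P (p : {linear P -> M}) (i : {linear K -> P}),
    [/\ fin_gen P, projective P & short_exact i p].

Fixpoint iter_presyz (n : nat) M K : Prop :=
  if n is n'.+1 then exists L, iter_presyz n' M L /\ presyz L K
  else mod_iso M K.

Lemma is_syzygy_presyz M K : is_syzygy M K -> presyz M K.
Proof. by case=> P [p [i [[fP prP [pon _]] iinj ex]]]; exists P, p, i; split. Qed.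

Lemma is_iter_syzygy_presyz n M K : is_iter_syzygy n M K -> iter_presyz n M K.
Proof.
elim: n K => [|n IH] K //= [L [LM KL]].
by exists L; split; [apply: IH | apply: is_syzygy_presyz].
Qed.

Lemma presyz_exists M : fin_gen M -> exists K, presyz M K.
Proof.
move=> /free_cover [n [p pon]]; have [K [i [iinj ex]]] := kernel_exists p.
exists K, (freemod n), p, i.
by split=> //; [apply: fin_gen_free | apply: projective_free].
Qed.

Lemma presyz_iso M K K' : presyz M K -> mod_iso K K' -> presyz M K'.
Proof.
move=> [P [p [i [fP prP [iinj ex pon]]]]] /mod_iso_sym [h [h' hK h'K]].
exists P, p, (i \o h); split=> //; split=> //.
- exact: inj_comp iinj (can_inj hK).
- move=> y; split=> [/ex [x <-]|[x <-]]; first by exists (h' x); rewrite /= h'K.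
  exact: (exact_at0 _ ex).
Qed.

Lemma iter_presyz_iso n M K K' :
  iter_presyz n M K -> mod_iso K K' -> iter_presyz n M K'.
Proof.
case: n => [|n] /=.
  by case=> f fb [g gb]; exists (g \o f); apply: bij_comp.
by case=> L [ML LK] KK'; exists L; split=> //; apply: presyz_iso LK KK'.
Qed.

Lemma iter_presyzD s n M K U :
  iter_presyz s M K -> iter_presyz n K U -> iter_presyz (n + s) M U.
Proof.
move=> MK; elim: n U => [|n IH] U /=; first exact: iter_presyz_iso.
by case=> L [/IH ML LU]; exists L.
Qed.

Lemma presyz_prod M M' K K' :
  presyz M K -> presyz M' K' -> presyz (M * M')%type (K * K')%type.
Proof.
move=> [P [p [i [fP prP [iinj ex pon]]]]] [P' [p' [i' [fP' prP' [iinj' ex' pon']]]]].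
exists (P * P')%type, (prodmap p p'), (prodmap i i').
split; [exact: fin_gen_prod | exact: projective_prod | split].
- by move=> [x y] [x' y'] /= [/iinj -> /iinj' ->].
- move=> [y y']; split=> /=.
    by case=> /ex [x <-] /ex' [x' <-]; exists (x, x').
  by case=> -[x x'] [<- <-] /=; rewrite (exact_at0 _ ex) (exact_at0 _ ex').
- move=> [y y']; have [x <-] := pon y; have [x' <-] := pon' y'.
  by exists (x, x').
Qed.

Lemma iter_presyz_prod n M M' K K' : iter_presyz n M K -> iter_presyz n M' K' ->
  iter_presyz n (M * M')%type (K * K')%type.
Proof.
elim: n K K' => [|n IH] K K' /=.
  move=> /mod_isoP[f [f' [fK f'K]]] /mod_isoP[g [g' [gK g'K]]].
  by exists (prodmap f g), (prodmap f' g') => -[x y] /=; rewrite ?fK ?gK ?f'K ?g'K.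
move=> [L [ML LK]] [L' [ML' LK']]; exists (L * L')%type.
by split; [apply: IH | apply: presyz_prod].
Qed.

(** * Stable retracts and their syzygies *)

(* [U] is a retract of [V * P]: equivalent to [is_summand_upto_proj U V]. *)
Definition stable_retract U V : Prop :=
  exists P (a : {linear U -> V}) (b : {linear V -> U})
      (c : {linear U -> P}) (d : {linear P -> U}),
    [/\ fin_gen P, projective P & forall x, b (a x) + d (c x) = x].

(** The components of an isomorphism from [U * W] to [V * P] give the four maps. Conversely,
    [sumap b d] is a retraction of [pairmap a c], so its kernel is a complement of [U] in
    [V * P]. *)
Lemma stable_retractP U V : is_summand_upto_proj U V <-> stable_retract U V.
Proof.
split=> [[P [fP prP [W /mod_isoP[h [k [hK kK]]]]]]|[P [a [b [c [d [fP prP E]]]]]]].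
  exists P, (fst \o (h \o inl_map U W)), (fst \o (k \o inl_map V P)),
    (snd \o (h \o inl_map U W)), (fst \o (k \o inr_map V P)); split=> // x /=.
  set y := h _; transitivity (k (inl_map V P y.1 + inr_map V P y.2)).1.
    by rewrite linearD.
  have -> : inl_map V P y.1 + inr_map V P y.2 = y.
    by rewrite [RHS]surjective_pairing /=; congr (_, _); rewrite ?addr0 ?add0r.
  by rewrite /y hK.
exists P; split=> //; pose r := sumap b d.
pose s := pairmap a c; have rs z : r (s z) = z := E z.
have [W [i [iinj ex]]] := kernel_exists r; exists W; apply: mod_iso_sym.
(* The projection [1 - s r] onto the kernel of [r]. *)
have [t tP] : exists t : {linear (V * P)%type -> W}, forall x, i (t x) = x - s (r x).
  apply: (lift_kernel (f := idfun \- (s \o r)) iinj ex) => x.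
  by rewrite -[LHS]/(r (x - s (r x))) linearB rs subrr.
have ri w : r (i w) = 0 by apply: (exact_at0 _ ex).
exists (pairmap r t); exists (sumap s i) => [x|[u w]].
  by rewrite -[LHS]/(s (r x) + i (t x)) tP addrC subrK.
rewrite -[LHS]/(r (s u + i w), t (s u + i w)).
have E1 : r (s u + i w) = u by rewrite linearD rs ri addr0.
by congr (_, _) => //; apply: iinj; rewrite tP E1 addrC addKr.
Qed.

Lemma stable_retract_iso U V : mod_iso U V -> stable_retract U V.
Proof.
move=> /mod_isoP [f [g [fK gK]]]; exists (freemod 0), f, g, \0, \0.
by split=> [||x]; [exact: fin_gen_free|exact: projective_free|rewrite /= addr0 fK].
Qed.

Lemma stable_retract_trans U V W :
  stable_retract U V -> stable_retract V W -> stable_retract U W.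
Proof.
move=> [P [a [b [c [d [fP prP E]]]]]] [Q [a' [b' [c' [d' [fQ prQ E']]]]]].
exists (Q * P)%type, (a' \o a), (b \o b'), (pairmap (c' \o a) c), (sumap (b \o d') d).
split=> [||x /=]; [exact: fin_gen_prod | exact: projective_prod|].
by rewrite addrA -linearD E' E.
Qed.

Lemma stable_retract_prod U U' V V' : stable_retract U V -> stable_retract U' V' ->
  stable_retract (U * U')%type (V * V')%type.
Proof.
move=> [P [a [b [c [d [fP prP E]]]]]] [Q [a' [b' [c' [d' [fQ prQ E']]]]]].
exists (P * Q)%type, (prodmap a a'), (prodmap b b'), (prodmap c c'), (prodmap d d').
split=> [||[x x']]; [exact: fin_gen_prod | exact: projective_prod|].
by rewrite -[RHS]/(x, x') -[in RHS](E x) -[in RHS](E' x').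
Qed.

Lemma stable_retract_proj P V : fin_gen P -> projective P -> stable_retract P V.
Proof.
move=> fP prP; exists P, \0, \0, idfun, idfun.
by split=> // x /=; rewrite add0r.
Qed.

(** Lift [a], [b] and [d] to the projective presentations. The lifts of [a] and [b] restrict to the
    kernels, where they compose to the identity up to a map factoring through [P0]. *)
Lemma stable_retract_presyz U V K L :
  stable_retract U V -> presyz U K -> presyz V L -> stable_retract K L.
Proof.
move=> [P [a [b [c [d [fP prP E]]]]]] [P0 [p [i [fP0 prP0 [iinj exi pon]]]]].
move=> [Q0 [q [j [fQ0 prQ0 [jinj exj qon]]]]].
have [a0 a0P] := prP0 _ _ q (a \o p) qon.
have [b0 b0P] := prQ0 _ _ p (b \o q) pon.
have [d0 d0P] := prP _ _ p d pon.
have [a1 a1P] : exists a1 : {linear K -> L}, forall x, j (a1 x) = a0 (i x).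
  apply: (lift_kernel (f := a0 \o i) jinj exj) => x.
  by rewrite /= a0P /= (exact_at0 _ exi) linear0.
have [b1 b1P] : exists b1 : {linear L -> K}, forall x, i (b1 x) = b0 (j x).
  apply: (lift_kernel (f := b0 \o j) iinj exi) => x.
  by rewrite /= b0P /= (exact_at0 _ exj) linear0.
(* The defect [1 - b0 a0 - d0 c p] of the lifted retraction lands in [K]. *)
have [e eP] : exists e : {linear P0 -> K},
    forall x, i (e x) = x - (b0 (a0 x) + d0 (c (p x))).
  apply: (lift_kernel (f := idfun \- ((b0 \o a0) \+ (d0 \o (c \o p)))) iinj exi) => x /=.
  by rewrite linearB linearD b0P /= a0P /= d0P E subrr.
(* On the image of [i] the term [d0 c p] vanishes, so [e i] is exactly [1 - b1 a1]. *)
exists P0, a1, b1, i, e; split=> // x; apply: iinj.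
rewrite linearD b1P a1P eP (exact_at0 x exi) !linear0 addr0.
by rewrite addrC subrK.
Qed.

(** For [U = V] this is the stable uniqueness of iterated syzygies, in the manner of Schanuel's
    lemma. *)
Lemma stable_retract_iter n U V K L : stable_retract U V ->
  iter_presyz n U K -> iter_presyz n V L -> stable_retract K L.
Proof.
move=> UV; elim: n K L => [|n IH] K L /=.
  move=> /mod_iso_sym/stable_retract_iso KU /stable_retract_iso VL.
  exact: stable_retract_trans KU (stable_retract_trans UV VL).
move=> [K' [UK' K'K]] [L' [VL' L'L]].
exact: stable_retract_presyz (IH _ _ UK' VL') K'K L'L.
Qed.

End Modules.

(** * Resolutions *)

(** The witness is the attained minimum; it may lie strictly below [n], as [S] is not assumed upward
    closed. *)
Lemma inf_natoo_leP (S : nat -> Prop) n :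
  le_natoo (inf_natoo S) (Some n) <-> exists n', (n' <= n)%N /\ S n'.
Proof.
rewrite /inf_natoo; case: pselect => [exS|nexS] /=.
  case: ex_minnP => m /asboolP Sm mmin; split=> [mn|[n' [n'n Sn']]]; first by exists m.
  by apply: leq_trans n'n; apply/mmin/asboolP.
by split=> // -[n' [_ Sn']]; case: nexS; exists n'; apply/asboolP.
Qed.

Section Resolutions.
Variable R : nzRingType.
Implicit Types A B E L M N K P Q U V W X Y Z : lmodType R.
Implicit Types T : nat -> lmodType R -> Prop.

(** A resolution of length [n] cut into short exact sequences, with [T i] the condition on its term
    of index [i]. This form allows induction on [n], the condition being shifted when passing to the
    kernel. *)
Fixpoint resolved (n : nat) T M : Prop :=
  if n is n'.+1 then
    exists X K (i : {linear K -> X}) (p : {linear X -> M}),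
      [/\ short_exact i p, T 0%N X & resolved n' (fun j => T j.+1) K]
  else exists X, mod_iso X M /\ T 0%N X.

Lemma resolved_sub n T T' M :
  (forall i X, (i <= n)%N -> T i X -> T' i X) -> resolved n T M -> resolved n T' M.
Proof.
elim: n T T' M => [|n IH] T T' M TT' /=.
  by case=> X [XM TX]; exists X; split=> //; apply: TT'.
case=> X [K [i [p [ex TX rK]]]]; exists X, K, i, p; split=> //; first exact: TT'.
by apply: IH rK => j Y jn; apply: TT'.
Qed.

Lemma resolved_iso n T M M' : mod_iso M M' -> resolved n T M -> resolved n T M'.
Proof.
case: n => [|n] [f [g fK gK]] /=.
  case=> X [[h hb] TX]; exists X; split=> //; exists (f \o h).
  by apply: bij_comp => //; exists g.
case=> X [K [i [p [[iinj ex pon] TX rK]]]]; exists X, K, i, (f \o p); split=> //.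
split=> // [x|y].
  rewrite -ex /=; split=> [|->]; last by rewrite linear0.
  by rewrite -(linear0 f) => /(can_inj fK).
by have [x xy] := pon (g y); exists x; rewrite /= xy gK.
Qed.

Definition cons_term X (C : nat -> lmodType R) (i : nat) : lmodType R :=
  if i is j.+1 then C j else X.

Definition cons_diff X (C : nat -> lmodType R) (d : forall i, {linear C i.+1 -> C i})
    (e : {linear C 0%N -> X}) (i : nat) :
    {linear cons_term X C i.+1 -> cons_term X C i} :=
  match i with 0%N => e | j.+1 => d j end.

(** Induction on [n]: a long exact sequence is cut at the kernel of its augmentation, and spliced
    back by composing the augmentation of the kernel's resolution with the inclusion. *)
Lemma resolved_finite_resolution n T M :
  (forall i X, T i X -> fin_gen X) ->
  resolved n T M <->
  exists (C : nat -> lmodType R) (d : forall i, {linear C i.+1 -> C i})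
      (e : {linear C 0%N -> M}),
    finite_resolution n d e /\ forall i, (i <= n)%N -> T i (C i).
Proof.
elim: n T M => [|n IH] T M Tfg /=; split.
- case=> X [[f [g fK gK]] TX].
  exists (cons_term X (fun=> freemod R 0)), (fun=> \0), f.
  have zero (x : freemod R 0) : x = 0 by apply/ffunP => -[].
  split=> [|[]//]; split=> //.
  + by case=> [|i]; [apply: Tfg TX | apply: fin_gen_free].
  + by case.
  + by move=> y; exists (g y).
  + move=> y; split=> [|[x <-]]; last by rewrite linear0.
    by rewrite -(linear0 f) => /(can_inj fK) ->; exists 0.
  + by move=> i y; split=> // _; exists 0; rewrite (zero y).
- case=> C [d [e [[Cfg C0 eon ex0 ex] TC]]]; exists (C 0%N); split; last exact: TC.
  (* The term of index 1 is zero, so exactness makes the augmentation an isomorphism. *)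
  have einj : injective e.
    apply: raddf_inj => x /ex0 [y <-].
    by rewrite (C0 1%N isT y) linear0.
  have [g gP] := choice eon.
  by exists e, g => // x; apply: einj; rewrite gP.
- case=> X [K [i [p [[iinj exi pon] TX]]]].
  case/IH=> [j Y TY|C [d [e [[Cfg C0 eon ex0 ex] TC]]]]; first exact: Tfg TY.
  exists (cons_term X C), (cons_diff d (i \o e)), p.
  split=> [|[//|j] jn]; last exact: TC.
  split=> //.
  + by case=> [|j]; [apply: Tfg TX | apply: Cfg].
  + by case=> [//|j] jn; apply: C0.
  + move=> y; rewrite exi; split=> -[x <-]; last by exists (e x).
    by have [z <-] := eon x; exists z.
  + case=> [|j]; last exact: ex.
    move=> y /=; rewrite -ex0; split=> [|->]; last by rewrite linear0.
    by rewrite -(linear0 i) => /iinj.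
case=> C [d [e [[Cfg C0 eon ex0 ex] TC]]].
have [K [i [iinj exi]]] := kernel_exists e.
exists (C 0%N), K, i, e; split; [by split| exact: TC |].
have [e' e'P] : exists e' : {linear C 1%N -> K}, forall x, i (e' x) = d 0%N x.
  by apply: (lift_kernel iinj exi) => x; apply: (exact_at0 _ ex0).
apply/IH; first by move=> j Y; apply: Tfg.
exists (fun j => C j.+1), (fun j => d j.+1), e'; split; last by move=> j jn; apply: TC.
split=> //.
- by move=> j jn; apply: C0.
- move=> y; have /ex0 [x xy] : e (i y) = 0 by apply: (exact_at0 _ exi).
  by exists x; apply: iinj; rewrite e'P.
- move=> y; rewrite -ex -e'P; split=> [->|]; first by rewrite linear0.
  by rewrite -(linear0 i) => /iinj.
Qed.

(** With [b] a lift of [q] through [g], the map [f p + b] from [X * P] is onto [B]; its kernel maps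
    to [L] by the second coordinate, and the part over 0 is [K]. *)
Lemma horseshoe A B (C : lmodType R) X K P (f : {linear A -> B}) (g : {linear B -> C})
    (p : {linear X -> A}) (i : {linear K -> X})
    (q : {linear P -> C}) L (j : {linear L -> P}) :
  short_exact f g -> short_exact i p -> projective P -> short_exact j q ->
  exists (r : {linear (X * P)%type -> B}) E (e : {linear E -> (X * P)%type})
      (k : {linear K -> E}) (l : {linear E -> L}),
    short_exact e r /\ short_exact k l.
Proof.
move=> [finj exf gon] [iinj exi pon] prP [jinj exj qon].
have [b bP] := prP _ _ g q gon.
pose r := sumap (f \o p) b.
have [E [e [einj exe]]] := kernel_exists r.
have gr x : g (r x) = q x.2 by rewrite /r /= linearD (exact_at0 _ exf) add0r bP.
have [k kP] : exists k : {linear K -> E}, forall x, e (k x) = (i x, 0).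
  apply: (lift_kernel (f := inl_map X P \o i) einj exe) => x.
  by rewrite /r /= (exact_at0 _ exi) !linear0 addr0.
have [l lP] : exists l : {linear E -> L}, forall x, j (l x) = (e x).2.
  apply: (lift_kernel (f := snd \o e) jinj exj) => x.
  by rewrite /= -gr (exact_at0 _ exe) linear0.
exists r, E, e, k, l; split; split=> //.
- move=> y; have [z zP] := qon (g y).
  have /exf [a aP] : g (y - b z) = 0 by rewrite linearB bP zP subrr.
  by have [x xa] := pon a; exists (x, z); rewrite /r /= xa aP subrK.
- by move=> x y /(congr1 e); rewrite !kP => -[/iinj].
- move=> y; split=> [ly|[x <-]]; last first.
    by apply: jinj; rewrite lP kP linear0.
  have y2 : (e y).2 = 0 by rewrite -lP ly linear0.
  have /exi [x xP] : p (e y).1 = 0.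
    apply: finj; rewrite linear0 -[RHS](exact_at0 y exe) /r /=.
    by rewrite y2 linear0 addr0.
  by exists x; apply: einj; rewrite kP xP -y2 -surjective_pairing.
(* To hit [y], the element [b (j y)] lies over 0 in [C], hence comes from some [x] in [X], and
   [(- x, j y)] is in the kernel of [r]. *)
- move=> y; have /exf [a aP] : g (b (j y)) = 0 by rewrite bP (exact_at0 _ exj).
  have [x xa] := pon a.
  have /exe [z zP] : r (- x, j y) = 0.
    by rewrite /r /= !linearN xa aP addNr.
  by exists z; apply: jinj; rewrite lP zP.
Qed.

Definition noetherian : Prop :=
  forall M N (f : {linear M -> N}), injective f -> fin_gen N -> fin_gen M.

Definition has_projective_covers : Prop :=
  forall M, fin_gen M -> exists P (p : {linear P -> M}), projective_cover p.

Hypothesis noethR : noetherian.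

Lemma presyz_fin_gen M K : presyz M K -> fin_gen K.
Proof. by case=> P [p [i [fP _ [iinj _ _]]]]; apply: noethR iinj fP. Qed.

Lemma iter_presyz_fin_gen n M K : fin_gen M -> iter_presyz n M K -> fin_gen K.
Proof.
case: n => [|n] /= fM; last by case=> L [_ /presyz_fin_gen].
by case=> f [g fK gK]; apply: fin_gen_onto fM _ => y; exists (g y).
Qed.

Lemma iter_presyz_exists n M : fin_gen M -> exists K, iter_presyz n M K.
Proof.
move=> fM; elim: n => [|n [L ML]]; first by exists M, idfun, idfun.
have [K LK] := presyz_exists (iter_presyz_fin_gen fM ML).
by exists K, L.
Qed.

(** * Syzygies and extensions of resolved modules *)

(** The horseshoe lemma for the first step 0 -> Y -> X -> M -> 0 of the resolution gives 0 -> K1 ->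
    E -> K -> 0, with [E] a syzygy of [X] and [K1] one of [Y]; induction applies to [Y]. *)
Lemma resolved_presyz n T T' M K :
  (forall i X, T i X -> fin_gen X) ->
  (forall i X L, (i <= n)%N -> T i X -> presyz X L -> T' i L) ->
  resolved n T M -> presyz M K -> resolved n T' K.
Proof.
elim: n T T' M K => [|n IH] T T' M K Tfg TT' /=.
  case=> X [/mod_isoP[f [g [fK gK]]] TX] [P [q [j [fP prP [jinj exj qon]]]]].
  exists K; split; first by exists idfun, idfun.
  apply: (TT' _ X) => //; exists P, (g \o q), j; split=> //; split=> //.
    move=> y; rewrite -exj /=; split=> [|->]; last by rewrite linear0.
    by rewrite -(linear0 g) => /(can_inj gK).
  by move=> y; have [x xP] := qon (f y); exists x; rewrite /= xP fK.
case=> X [Y [i [p [sp TX rY]]]] [P [q [j [fP prP sq]]]].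
have [iinj _ _] := sp.
have [K1 YK1] := presyz_exists (noethR iinj (Tfg _ _ TX)).
have [P1 [q1 [j1 [fP1 prP1 sq1]]]] := YK1.
have [r [E [e [k [l [se sk]]]]]] := horseshoe sp sq1 prP sq.
exists E, K1, k, l; split=> //.
  apply: (TT' _ X) => //; exists (P1 * P)%type, r, e.
  by split=> //; [apply: fin_gen_prod | apply: projective_prod].
apply: (IH (fun j => T j.+1) (fun j => T' j.+1) Y) => // [j0 Z|j0 Z L]; first exact: Tfg.
by move=> jn; apply: (TT' j0.+1 Z).
Qed.

(** Terms 0 to [n] are the terms for [A] plus projectives; what remains is a syzygy of [C] of order
    [n + 1], whose resolution of length [s] supplies the terms from index [n + 1] on. *)
Lemma resolved_extension n s TA T A B (C : lmodType R)
    (f : {linear A -> B}) (g : {linear B -> C}) :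
  (forall i X P, (i <= n)%N -> TA i X -> fin_gen P -> projective P ->
    T i (X * P)%type) ->
  (forall K, iter_presyz n.+1 C K -> resolved s (fun i => T (n.+1 + i)%N) K) ->
  fin_gen C -> short_exact f g -> resolved n TA A -> resolved (n + 1 + s) T B.
Proof.
elim: n TA T A B C f g => [|n IH] TA T A B C f g TAT rC fC sfg /=.
  case=> X [/mod_isoP[h [h' [hK h'K]]] TX].
  have [L CL] := presyz_exists fC; have [P [q [j [fP prP sq]]]] := CL.
  (* The isomorphism [h] is read as a short exact sequence with zero kernel, so that the horseshoe
     kernel [E] is isomorphic to [L]. *)
  have sh : short_exact (\0 : {linear freemod R 0 -> X}) h.
    have zero (x : freemod R 0) : x = 0 by apply/ffunP => -[].
    split=> [x y _|y|y]; first by rewrite (zero x) (zero y).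
      split=> [|[x <-]]; last by rewrite linear0.
      by rewrite -(linear0 h) => /(can_inj hK) ->; exists 0.
    by exists (h' y).
  have [r [E [e [k [l [se [kinj exk lon]]]]]]] := horseshoe sfg sh prP sq.
  exists (X * P)%type, E, e, r; split=> //; first exact: TAT.
  have EL : mod_iso L E.
    apply: mod_iso_sym; have [l' l'P] := choice lon.
    have linj : injective l.
      apply: raddf_inj => x /exk [y <-].
      by rewrite (_ : y = 0) ?linear0 //; apply/ffunP => -[].
    by exists l, l' => // x; apply: linj; rewrite l'P.
  apply: resolved_iso EL _; apply: rC; exists C; split=> //.
  by exists idfun, idfun.
case=> X [K [i [p [sp TX rK]]]].
have [L CL] := presyz_exists fC; have [P [q [j [fP prP sq]]]] := CL.
have [r [E [e [k [l [se sk]]]]]] := horseshoe sfg sp prP sq.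
exists (X * P)%type, E, e, r; split=> //; first exact: TAT.
apply: (IH (fun j => TA j.+1) (fun j => T j.+1) K E L k l) => // [j0 Y Q|Z LZ|].
- by move=> jn; apply: (TAT j0.+1).
(* A syzygy of order [n + 1] of [L] is one of order [n + 2] of [C]. *)
- apply: rC; rewrite -addn1; apply: iter_presyzD LZ.
  by exists C; split=> //; exists idfun, idfun.
- exact: presyz_fin_gen CL.
Qed.

(** * Upper bounds on [dell] *)

(** Expresses that [dell j M] is at most [n], see [dell_leP]: the exponent is [n] itself, and
    syzygies come from any projective presentations. *)
Definition looped (j n : nat) M : Prop := exists N U V,
  [/\ fin_gen N, iter_presyz n M U, iter_presyz (n + j) N V & stable_retract U V].

Lemma loopedS j n M : fin_gen M -> looped j n M -> looped j n.+1 M.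
Proof.
move=> fM [N [U [V [fN MU NV UV]]]].
have [U' UU'] := presyz_exists (iter_presyz_fin_gen fM MU).
have [V' VV'] := presyz_exists (iter_presyz_fin_gen fN NV).
exists N, U', V'; split=> //; [by exists U | by exists V |].
exact: stable_retract_presyz UV UU' VV'.
Qed.

Lemma looped_leq j n n' M : fin_gen M -> (n <= n')%N -> looped j n M -> looped j n' M.
Proof.
move=> fM /subnK <-; elim: (n' - n)%N => // i IH /IH.
exact: loopedS.
Qed.

Lemma looped_prod j n M M' : looped j n M -> looped j n M' ->
  looped j n (M * M')%type.
Proof.
move=> [N [U [V [fN MU NV UV]]]] [N' [U' [V' [fN' MU' NV' UV']]]].
exists (N * N')%type, (U * U')%type, (V * V')%type.
split; [exact: fin_gen_prod | exact: iter_presyz_prod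
  | exact: iter_presyz_prod | exact: stable_retract_prod].
Qed.

(** Take [N = P]: a projective is a stable retract of any module, in particular of its own syzygy of
    order [j], and syzygies of order [n] preserve this. *)
Lemma looped_projective j n P : fin_gen P -> projective P -> looped j n P.
Proof.
move=> fP prP; have [W PW] := iter_presyz_exists j fP.
have [U PU] := iter_presyz_exists n fP.
have [V WV] := iter_presyz_exists n (iter_presyz_fin_gen fP PW).
exists P, U, V; split=> //; first exact: iter_presyzD PW WV.
exact: stable_retract_iter (stable_retract_proj W fP prP) PU WV.
Qed.

(** Raise the exponent from [n] to [n + s], then read the syzygy of order [n + s] of [M] as one of
    order [n] of [K]; the surplus [s] moves into the index [j]. *)
Lemma looped_presyz s j n M K : fin_gen M -> looped j n M -> iter_presyz s M K ->
  looped (s + j) n K.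
Proof.
move=> fM lM MK.
have [N [U [V [fN MU NV UV]]]] := looped_leq fM (leq_addr s n) lM.
have [U' KU'] := iter_presyz_exists n (iter_presyz_fin_gen fM MK).
exists N, U', V; split=> //; first by rewrite addnA.
apply: stable_retract_trans UV.
apply: stable_retract_iter (iter_presyzD MK KU') MU.
by apply: stable_retract_iso; exists idfun, idfun.
Qed.

Hypothesis coversR : has_projective_covers.

Lemma is_iter_syzygy_exists n M : fin_gen M -> exists K, is_iter_syzygy n M K.
Proof.
move=> fM; elim: n => [|n [L ML]]; first by exists M, idfun, idfun.
have fL := iter_presyz_fin_gen fM (is_iter_syzygy_presyz ML).
have [P [p cp]] := coversR fL; have [K [i [iinj exi]]] := kernel_exists p.
by exists K, L; split=> //; exists P, p, i.
Qed.

(** Projective covers provide minimal syzygies, and these are stable retracts of all others of the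
    same order, and conversely. *)
Lemma dell_leP j n M : fin_gen M ->
  le_natoo (dell j M) (Some n) <-> looped j n M.
Proof.
move=> fM; rewrite inf_natoo_leP; split.
  move=> [n' [n'n [N [U [V [fN MU NV /stable_retractP UV]]]]]].
  apply: looped_leq n'n _ => //; exists N, U, V.
  by split=> //; apply: is_iter_syzygy_presyz.
move=> [N [U [V [fN MU NV UV]]]]; exists n; split=> //.
have [U' MU'] := is_iter_syzygy_exists n fM.
have [V' NV'] := is_iter_syzygy_exists (n + j) fN.
exists N, U', V'; split=> //; apply/stable_retractP.
have rfl X : stable_retract X X by apply: stable_retract_iso; exists idfun, idfun.
apply: stable_retract_trans (stable_retract_iter (rfl M) _ MU) _.
  exact: is_iter_syzygy_presyz.
apply: stable_retract_trans UV (stable_retract_iter (rfl N) NV _).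
exact: is_iter_syzygy_presyz.
Qed.

(** * Upper bounds on [ddell] *)

Definition ddell_term (k m i : nat) X := fin_gen X /\ looped (i + k) (m - i) X.

Lemma ddell_leP k m M : le_natoo (ddell k M) (Some m) <->
  exists m' n, [/\ (m' <= m)%N, (n <= m')%N & resolved n (ddell_term k m') M].
Proof.
rewrite inf_natoo_leP; split.
  move=> [m' [m'm [n [nm' [C [d [e [fr dC]]]]]]]]; exists m', n; split=> //.
  apply/resolved_finite_resolution; first by move=> i X [].
  exists C, d, e; split=> // i i_n.
  have fC : fin_gen (C i) by case: fr.
  by split=> //; apply/dell_leP => //; apply: dC.
move=> [m' [n [m'm nm' /resolved_finite_resolution]]].
case=> [i X []|C [d [e [fr dC]]]] //; exists m'; split=> //; exists n; split=> //.
exists C, d, e; split=> // i i_n; have [fC lC] := dC i i_n.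
exact/dell_leP.
Qed.

(** Each syzygy raises the index of [looped] by one and keeps its bound [m - i]. *)
Lemma resolved_iter_presyz k m n s M K :
  resolved n (ddell_term k m) M -> iter_presyz s M K ->
  resolved n (fun i X => fin_gen X /\ looped (s + (i + k)) (m - i) X) K.
Proof.
move=> rM; elim: s K => [|s IH] K /=; first by move=> /resolved_iso; apply.
case=> L [/IH rL LK]; apply: resolved_presyz rL LK => [i X []//|i X L' _ [fX lX] XL'].
split; first exact: presyz_fin_gen XL'.
rewrite addSn -add1n.
by apply: (looped_presyz fX lX); exists X; split=> //; exists idfun, idfun.
Qed.

Theorem ddell_extension k m1 m2 A B (C : lmodType R)
    (f : {linear A -> B}) (g : {linear B -> C}) :
  fin_gen C -> short_exact f g ->
  le_natoo (ddell k A) (Some m1) -> le_natoo (ddell k C) (Some m2) ->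
  le_natoo (ddell k B) (Some (m1 + m2 + 1)%N).
Proof.
move=> fC sfg /ddell_leP [m1' [n1 [m1'1 n1m rA]]] /ddell_leP [m2' [n2 [m2'2 n2m rC]]].
apply/ddell_leP; exists (m1' + m2' + 1)%N, (n1 + 1 + n2)%N; split.
- by rewrite leq_add2r leq_add.
- by rewrite -addnA [(1 + n2)%N]addnC addnA leq_add2r leq_add.
apply: resolved_extension fC sfg rA => [i X P i_n [fX lX] fP prP|K CK].
  split; first exact: fin_gen_prod.
  apply: looped_prod; last exact: looped_projective.
  by apply: looped_leq lX => //; rewrite -addnA leq_sub2r // leq_addr.
(* The term at position [n1 + 1 + i] needs the index [n1 + 1 + i + k], which is what the syzygies of
   order [n1 + 1] provide; the bound [m2' - i] suffices because [n1 <= m1']. *)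
apply: resolved_sub (resolved_iter_presyz rC CK) => i X i_n [fX lX].
split=> //; rewrite -addnA; apply: looped_leq lX => //.
by lia.
Qed.

End Resolutions.

(** * Finite dimensional algebras *)

(** A subspace of maximal dimension inside [S] absorbs every [x] in [S], since adding the line of
    [x] stays inside [S]. *)
Lemma subspace_vspace (F : fieldType) (vT : vectType F) (S : vT -> Prop) :
  S 0 -> (forall a x y, S x -> S y -> S (a *: x + y)) ->
  exists U : {vspace vT}, forall x, S x <-> x \in U.
Proof.
move=> S0 SP.
pose D d := `[< exists U : {vspace vT}, (forall x, x \in U -> S x) /\ \dim U = d >].
have exD : exists d, D d.
  exists 0%N; apply/asboolP; exists 0%VS; rewrite dimv0; split=> // x.
  by rewrite memv0 => /eqP ->.
have boundD d : D d -> (d <= \dim {:vT})%N.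
  by move=> /asboolP [U [_ <-]]; apply/dimvS/subvf.
case: (ex_maxnP exD boundD) => d /asboolP [U [US dU]] dmax.
exists U => x; split=> [Sx|]; last exact: US.
have : D (\dim (<[x]> + U)%VS).
  apply/asboolP; exists (<[x]> + U)%VS; split=> // y.
  by move=> /memv_addP [_ /vlineP [c ->] [z zU ->]]; apply: SP => //; apply: US.
move=> /dmax; rewrite -dU => dle.
have /eqP -> : U == (<[x]> + U)%VS by rewrite eqEdim addvSr.
by apply/(subvP (addvSl _ _))/memv_line.
Qed.

(** * Finite generation and projective covers by dimension count *)

Section FiniteDimensional.
Variables (F : fieldType) (Lambda : falgType F).
Local Notation R := (Lambda : nzRingType)^c.
Local Notation vec n := {ffun 'I_n -> Lambda}.

(** Identifies the two structures on the same functions: over the converse ring, [c%:A] acts by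
    right multiplication on each coordinate, which is scaling by [c]. *)
Lemma scale_vecE n (c : F) (x : vec n) :
  c *: x = (c%:A : R) *: (x : freemod R n) :> freemod R n.
Proof. by apply/ffunP => i; rewrite !ffunE -[RHS]/(x i * c%:A) mulr_algr. Qed.

Lemma vec_linear n m (u : {linear freemod R n -> freemod R m}) :
  linear (u : vec n -> vec m).
Proof.
move=> a x y; rewrite scale_vecE.
by rewrite -[LHS]/(u (_ *: (x : freemod R n) + (y : freemod R n))) linearP -scale_vecE.
Qed.

(** The same function as [u], seen as a map of vector spaces so that its image and kernel have
    dimensions. *)
Definition vec_hom n m (u : {linear freemod R n -> freemod R m}) :
    'Hom(vec n, vec m) :=
  linfun (HB.pack_for {linear vec n -> vec m} (u : vec n -> vec m)
    (GRing.isLinear.Build F (vec n) (vec m) *:%R (u : vec n -> vec m) (vec_linear u))).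

Lemma vec_homE n m (u : {linear freemod R n -> freemod R m}) (x : vec n) :
  vec_hom u x = u x.
Proof. by rewrite lfunE. Qed.

Lemma mem_limg_vec_hom n m (u : {linear freemod R n -> freemod R m}) (y : vec m) :
  y \in limg (vec_hom u) <-> exists x, u x = y.
Proof.
split=> [/memv_imgP [x _ ->]|[x <-]]; first by exists x; rewrite vec_homE.
by rewrite -vec_homE memv_img ?memvf.
Qed.

(** The elements of a free cover of [N] whose image lies in [M] form a finite dimensional subspace;
    an F-basis of it yields generators of [M]. *)
Lemma falg_noetherian : noetherian R.
Proof.
move=> M N f finj /free_cover [n [p pon]].
have [||U UP] := @subspace_vspace F (vec n) (fun v => exists x, f x = p v).
- by exists 0; rewrite !linear0.
- move=> a x y [x' xP] [y' yP]; exists ((a%:A : R) *: x' + y').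
  rewrite linearP xP yP scale_vecE.
  by rewrite -[RHS]/(p (_ *: (x : freemod R n) + (y : freemod R n))) linearP.
have /choice [x xP] : forall i : 'I_(\dim U), exists x, f x = p (vbasis U)`_i.
  by move=> i; apply/UP/vbasis_mem/mem_nth; rewrite size_tuple.
exists (\dim U), x => z; have [v vP] := pon (f z).
have /coord_vbasis vE : (v : vec n) \in U by apply/UP; exists z.
exists (fun i => (coord (vbasis U) i v)%:A); apply: finj.
rewrite -vP [in LHS]vE !linear_sum; apply: eq_bigr => i _.
by rewrite linearZ xP scale_vecE linearZ.
Qed.

Lemma falg_projective_covers : has_projective_covers R.
Proof.
move=> M /free_cover [n [p pon]].
pose D d := `[< exists u : {linear freemod R n -> freemod R n},
  (forall x, p (u x) = p x) /\ \dim (limg (vec_hom u)) = d >].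
have exD : exists d, D d.
  pose id1 : {linear freemod R n -> freemod R n} := idfun.
  by exists (\dim (limg (vec_hom id1))); apply/asboolP; exists id1.
case: (ex_minnP exD) => _ /asboolP [u [pu <-]] dmin.
(* As [u] has minimal rank among the endomorphisms over [M], [u \o u] has the
   same image, so [u] restricts to an automorphism of its image. That makes the
   image projective; minimality also makes it essential over [M]. *)
have {}dmin (w : {linear freemod R n -> freemod R n}) : (forall x, p (w x) = p x) ->
    (\dim (limg (vec_hom u)) <= \dim (limg (vec_hom w)))%N.
  by move=> pw; apply: dmin; apply/asboolP; exists w.
have imS : submodule (fun y => exists x, u x = y).
  split=> [|a _ _ [x <-] [y <-]]; first by exists 0; rewrite linear0.
  by exists (a *: x + y); rewrite linearP.
have [I [j [jinj jP]]] := submodule_exists imS.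
have /choice [u1 u1P] : forall x, exists z, j z = u x by move=> x; apply/jP; exists x.
have u1L : linear u1 by move=> a x y; apply: jinj; rewrite linearP !u1P linearP.
have {u1 u1L u1P} [u1 u1P] : exists u1 : {linear freemod R n -> I}, forall x, j (u1 x) = u x.
  by exists (lin_of u1L).
have u1on : onto u1.
  move=> z; have [x xP] : exists x, u x = j z by apply/jP; exists z.
  by exists x; apply: jinj; rewrite u1P.
have imuu : limg (vec_hom (u \o u)) = limg (vec_hom u).
  apply/eqP; rewrite eqEdim dmin ?andbT; last by move=> x /=; rewrite !pu.
  by apply/subvP => y /mem_limg_vec_hom [x <-]; apply/mem_limg_vec_hom; exists (u x).
have uj_on : onto (u1 \o j).
  move=> z; have : (j z : vec n) \in limg (vec_hom u).
    by apply/mem_limg_vec_hom/jP; exists z.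
  rewrite -imuu => /mem_limg_vec_hom [x xP].
  have [y yP] : exists y, j y = u x by apply/jP; exists x.
  by exists y; apply: jinj; rewrite /= u1P yP.
have uj_inj : injective (u1 \o j).
  apply: raddf_inj => z /(congr1 j); rewrite /= u1P linear0 => ujz.
  have jz : (j z : vec n) \in (limg (vec_hom u) :&: lker (vec_hom u))%VS.
    rewrite memv_cap memv_ker vec_homE ujz eqxx andbT.
    by apply/mem_limg_vec_hom/jP; exists z.
  (* Rank-nullity for [u] restricted to its image, which [u] maps onto itself. *)
  have : \dim (limg (vec_hom u) :&: lker (vec_hom u)) == 0%N.
    rewrite -(eqn_add2r (\dim (vec_hom u @: limg (vec_hom u)))) limg_ker_dim add0n.
    rewrite -[in X in X == _]imuu; apply/eqP; congr (\dim _).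
    rewrite -limg_comp; congr (_ @: _)%VS; apply/lfunP => x.
    by rewrite comp_lfunE !vec_homE.
  rewrite dimv_eq0 => /eqP cap0; move: jz; rewrite cap0 memv0 => /eqP jz.
  by apply: jinj; rewrite linear0.
have [t tP] : exists t : {linear I -> I}, forall z, u1 (j (t z)) = z.
  have [t tP] := choice uj_on.
  have tE z : u1 (j (t z)) = z by apply: tP.
  have tL : linear t by move=> a x y; apply: uj_inj; rewrite /= tE !linearP !tE.
  by exists (lin_of tL).
exists I, (p \o j); split.
- exact: fin_gen_onto (fin_gen_free _ _) u1on.
- move=> X Y g f gon.
  have [h hP] := @projective_free R n X Y g (f \o u1) gon.
  by exists (h \o (j \o t)) => z; rewrite /= hP /= tP.
split=> [y|X h hon].
  by have [x <-] := pon y; exists (u1 x); rewrite /= u1P pu.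
(* Lifting [p] through the composite from [X] makes [j h s] an endomorphism over [M] with image
   inside that of [u]; by minimal rank the images agree, so [h] is onto. *)
have [s sP] := @projective_free R n X M (p \o j \o h) p hon.
have sub : (limg (vec_hom (j \o (h \o s))) <= limg (vec_hom u))%VS.
  apply/subvP => y /mem_limg_vec_hom [x <-]; apply/mem_limg_vec_hom/jP.
  by exists (h (s x)).
have imE : limg (vec_hom (j \o (h \o s))) = limg (vec_hom u).
  by apply/eqP; rewrite eqEdim sub dmin.
move=> z; have : (j z : vec n) \in limg (vec_hom u).
  by apply/mem_limg_vec_hom/jP; exists z.
rewrite -imE => /mem_limg_vec_hom [x /= /jinj xz].
by exists (s x).
Qed.

End FiniteDimensional.

Theorem lemma3p1 (F : fieldType) (Lambda : falgType F) (k : nat)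
    (hk : (1 <= k)%N) (A B C : rmodType Lambda)
    (fgA : fin_gen A) (fgB : fin_gen B) (fgC : fin_gen C)
    (f : {linear A -> B}) (g : {linear B -> C}) (hfg : short_exact f g)
    (m1 m2 : nat) (hA : ddell k A = Some m1) (hC : ddell k C = Some m2) :
  le_natoo (ddell k B) (Some (m1 + m2 + 1)%N).
Proof.
apply: (ddell_extension (@falg_noetherian _ Lambda)
  (@falg_projective_covers _ Lambda) fgC hfg).
  by rewrite hA /=.
by rewrite hC /=.
Qed.
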